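(* Let $k\ge 2$ and let $\mathcal T$ be the join of the trees $\mathcal T^{(1)},\ldots,\mathcal T^{(k)}$ (with respect to a fixed vertex $v_i$ of each $\mathcal T^{(i)}$). Suppose that $z\in\mathbb C$ is, for each $i=1,\ldots,k$, a root of the polynomial $\operatorname{cox}_{\mathcal T^{(i)}}(t)$ with multiplicity $m_i$. Then $z$ is also a root of the polynomial $\operatorname{cox}_{\mathcal T}(t)$ with multiplicity at least $$\min\{m-m_i : i=1,2,\ldots,k\},$$ where $m=m_1+m_2+\cdots+m_k$.
   Context: Coxeter polynomial. Let $\Gamma$ be a tree with vertices $v_1,\ldots,v_n$ and adjacency matrix $[a_{ij}]$. For $1\le i\le n$ let $\sigma_i:\mathbb R^n\to\mathbb R^n$ be the linear map with $\sigma_i(e_j)=e_j-(2\delta_{ij}-a_{ij})e_i$, where $e_1,\ldots,e_n$ is the standard basis. The Coxeter transformation is $\Phi_\Gamma=\sigma_1\sigma_2\cdots\sigma_n$, and the Coxeter polynomial is its characteristic polynomial $\operatorname{cox}_\Gamma(t)=\det(t\cdot\mathrm{id}-\Phi_\Gamma)\in\mathbb Z[t]$; it does not depend on the enumeration of the vertices. Join. The join of graphs $\Gamma_1,\ldots,\Gamma_k$ with a fixed vertex $v_j$ in each $\Gamma_j$ is the graph obtained from their disjoint union by adding a new vertex $v$ and an edge from $v$ to $v_j$ for every $j=1,\ldots,k$. *)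

(* Defs.v *)
From HB Require Import structures.
From mathcomp Require Import all_boot all_order all_algebra.
From mathcomp Require Import reals.
From mathcomp Require Import complex.

Set Implicit Arguments.
Unset Strict Implicit.
Unset Printing Implicit Defensive.

Import Order.TTheory GRing.Theory Num.Theory.

Local Open Scope ring_scope.

(* A finite simple graph is a symmetric irreflexive relation on a finType. *)

Definition connected_graph (V : finType) (e : rel V) : Prop :=
  (0 < #|V|)%N /\ forall x y : V, connect e x y.

(* The closed walk x, y, x along a single edge is a [ucycle] of size 2, so the
   graph-theoretic cycles are the simple cyclic sequences of size at least 3. *)
Definition acyclic_graph (V : finType) (e : rel V) : Prop :=
  forall c : seq V, ucycle e c -> (size c <= 2)%N.

Definition is_tree (V : finType) (e : rel V) : Prop :=
  [/\ symmetric e, irreflexive e, connected_graph e & acyclic_graph e].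

(* [None] is the new vertex; [Some (Tagged V x)] is the vertex [x : V i]. *)
Definition join_rel (k : nat) (V : 'I_k -> finType)
    (e : forall i : 'I_k, rel (V i)) (v0 : forall i : 'I_k, V i) :
    rel (option {i : 'I_k & V i}) :=
  fun x y =>
    match x, y with
    | None, None => false
    | None, Some u | Some u, None => tagged u == v0 (tag u)
    | Some u, Some u' =>
        (tag u == tag u') && e (tag u) (tagged u) (tagged_as u u')
    end.

Section Coxeter.

Variables (R : comNzRingType) (V : finType) (e : rel V).
Variables (n : nat) (v : 'I_n -> V).

Definition adjacency : 'M[R]_n := \matrix_(i, j) (e (v i) (v j))%:R.

Definition std_basis (j : 'I_n) : 'cV[R]_n := delta_mx j 0.

Definition sigma_image (i j : 'I_n) : 'cV[R]_n :=
  std_basis j - ((i == j)%:R *+ 2 - adjacency i j) *: std_basis i.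

(* Linear maps are represented by their matrices acting on column vectors, so
   composition of maps is the matrix product in the same order. *)
Definition sigma (i : 'I_n) : 'M[R]_n := \matrix_(r, j) sigma_image i j r 0.

Lemma sigmaE (i j : 'I_n) : sigma i *m std_basis j = sigma_image i j.
Proof.
rewrite /std_basis -colE; apply/colP => r.
by rewrite !mxE.
Qed.

Definition coxeter_transformation : 'M[R]_n := \prod_(i < n) sigma i.

Definition coxeter_poly : {poly R} := char_poly coxeter_transformation.

End Coxeter.

Arguments coxeter_transformation R {V} e {n} v.
Arguments coxeter_poly R {V} e {n} v.

Definition complex_poly (R : rcfType) (p : {poly R}) : {poly R[i]} :=
  map_poly (real_complex R) p.

(* Main.v *)
(* Split the Cartan matrix of an enumerated graph as U + L with U upper and L
   lower unitriangular. Then the Coxeter transformation P satisfies U P = - L,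
   so the Coxeter polynomial is det (t U + L). For a tree this determinant does
   not depend on the enumeration: only involutive permutations along edges
   contribute to it, and each edge contributes the product t of its two entries.
   Enumerating the join as the new vertex followed by the trees one after the
   other gives a bordered block diagonal matrix, whose determinant is
     (t + 1) * prod_i cox_i - sum_i g_i * prod_(j != i) cox_j,
   and prod_(j != i) cox_j vanishes at z to order at least m - m_i. *)

Require Import Defs.
From HB Require Import structures.
From mathcomp Require Import all_boot all_order all_algebra.
From mathcomp Require Import perm.
From mathcomp Require Import reals.
From mathcomp Require Import complex.
From mathcomp Require Import ring.

Set Implicit Arguments.
Unset Strict Implicit.
Unset Printing Implicit Defensive.

Import Order.TTheory GRing.Theory Num.Theory.

Local Open Scope ring_scope.

(** * Permutations along the edges of acyclic graphs, and their determinants *)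

Lemma acyclic_graph_inj (U V : finType) (e : rel V) (f : U -> V) :
  injective f -> acyclic_graph e -> acyclic_graph (fun x y => e (f x) (f y)).
Proof.
move=> f_inj e_acyclic c /andP[c_cycle c_uniq].
rewrite -(size_map f); apply: e_acyclic.
by rewrite /ucycle map_inj_uniq // c_uniq andbT cycle_map.
Qed.

(** The orbit of a moved point is a duplicate-free closed walk in the graph, so acyclicity bounds
    its length by 2. *)
Lemma acyclic_perm_involutive (V : finType) (e : rel V) (p : {perm V}) :
  acyclic_graph e -> (forall x, p x != x -> e x (p x)) -> involutive p.
Proof.
move=> e_acyclic p_edge x; have p_inj := @perm_inj V p.
have [px|px_neq] := eqVneq (p x) x; first by rewrite !px.
have orbit_moved y : y \in orbit p x -> p y != y.
  rewrite -fconnect_orbit fconnect_sym // => /iter_findex xE.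
  apply: contra_neq px_neq => py.
  suff -> : x = y by [].
  by rewrite -xE; elim: (findex _ _ _) => //= l ->.
have : (size (orbit p x) <= 2)%N.
  apply: e_acyclic; rewrite /ucycle orbit_uniq andbT.
  apply: (@sub_in_cycle _ (mem (orbit p x)) (frel p)).
  - by move=> y z y_orb _ /eqP <-; apply/p_edge/orbit_moved.
  - by apply/allP.
  - exact: cycle_orbit.
rewrite size_orbit; have := iter_order p_inj x; have := fingraph.order_gt0 p x.
case: (fingraph.order p x) => [|[|[|k]]] //= _ px.
by rewrite px eqxx in px_neq.
Qed.

(** Compare Leibniz expansions term by term. A permutation moving a point along a non-edge
    contributes 0; any other is an involution, whose term involves only diagonal entries and
    products [A i j * A j i]. *)
Lemma det_acyclic (R : comNzRingType) (n : nat) (e : rel 'I_n) (A B : 'M[R]_n) :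
    acyclic_graph e ->
    (forall i, A i i = B i i) ->
    (forall i j, i != j -> ~~ e i j -> A i j = 0 /\ B i j = 0) ->
    (forall i j, A i j * A j i = B i j * B j i) ->
  \det A = \det B.
Proof.
move=> e_acyclic diagE offE edgeE; apply: eq_bigr => p _; congr (_ * _).
have [/existsP[i /andP[pi_neq not_edge]]|/existsPn p_edge] :=
  boolP [exists i, (p i != i) && ~~ e i (p i)].
  have [A0 B0] : A i (p i) = 0 /\ B i (p i) = 0 by apply: offE; rewrite 1?eq_sym.
  by rewrite (bigD1 i) // (bigD1 i (P := xpredT)) //= A0 B0 !mul0r.
have pK : involutive p.
  apply: (acyclic_perm_involutive e_acyclic) => i pi_neq.
  by have := p_edge i; rewrite pi_neq negbK.
(* Each 2-cycle is recorded at its smaller element; reindexing by [p] brings the factor of the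
   larger one there. *)
have pairE (C : 'M[R]_n) : \prod_i C i (p i) =
    \prod_(i | p i == i) C i i * \prod_(i : 'I_n | (i < p i)%N) (C i (p i) * C (p i) i).
  rewrite big_split /= (bigID (fun i => p i == i)) /=.
  congr (_ * _); first by apply: eq_bigr => i /eqP ->.
  rewrite (bigID (fun i : 'I_n => (i < p i)%N)) /=; congr (_ * _).
    by apply: eq_bigl => i; rewrite -val_eqE /= neq_ltn; case: ltngtP.
  rewrite (reindex_inj (@perm_inj _ p)) /=; apply: eq_big => [i|i _]; rewrite pK //.
  by rewrite -val_eqE /= neq_ltn; case: ltngtP.
rewrite !pairE; congr (_ * _); first by apply: eq_bigr => i _.
by apply: eq_bigr => i _.
Qed.

(** * Determinants of permuted, block diagonal and bordered matrices *)

Lemma det_mxsub_bij (R : comNzRingType) (m n : nat) (f : 'I_m -> 'I_n)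
  (A : 'M[R]_n) : bijective f -> \det (mxsub f f A) = \det A.
Proof.
move=> f_bij; have mn : m = n by have := bij_eq_card f_bij; rewrite !card_ord.
subst m; have f_inj := bij_inj f_bij.
have -> : mxsub f f A = row_perm (perm f_inj) (col_perm (perm f_inj) A).
  by apply/matrixP => i j; rewrite !mxE !permE.
rewrite row_permE col_permE !det_mulmx !det_perm odd_permV.
by rewrite mulrCA -signr_addb addbb mulr1.
Qed.

Lemma det_mxdiag (R : comNzRingType) (k : nat) (n : 'I_k -> nat)
  (B : forall i, 'M[R]_(n i)) : \det (\mxdiag_i B i) = \prod_i \det (B i).
Proof.
elim: k => [|k IHk] in n B *.
  have n0 : (\sum_(i < 0) n i = 0)%N by rewrite big_ord0.
  by rewrite [RHS]big_ord0; move: (\mxdiag_i B i); rewrite n0 => M; exact: det_mx00.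
have det_cast a b (ab : a = b) (M : 'M[R]_a) : \det (castmx (ab, ab) M) = \det M.
  by case: b / ab; rewrite castmx_id.
by rewrite mxdiag_recl det_cast det_ublock IHk big_ord_recl.
Qed.

Lemma mul_mxdiag (R : comNzRingType) (k : nat) (n : 'I_k -> nat)
  (A B : forall i, 'M[R]_(n i)) :
  \mxdiag_i A i *m \mxdiag_i B i = \mxdiag_i (A i *m B i).
Proof.
rewrite [X in _ *m X]/mxdiag mul_mxdiag_mxblock; apply/eq_mxblock => i j.
by case: eqVneq => [->|_]; rewrite ?conform_mx_id ?mulmx0.
Qed.

(* Multiplying on the right by the matrix [T] of the proof, built from the
   adjugate [Q] of the diagonal block, clears the lower left block. *)
Lemma det_bordered_mxdiag (R : idomainType) (k : nat) (n : 'I_k -> nat) (a : R)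
    (r : forall i, 'rV[R]_(n i)) (c : forall i, 'cV[R]_(n i))
    (B : forall i, 'M[R]_(n i)) :
    (forall i, \det (B i) != 0) ->
  \det (block_mx a%:M (\mxrow_i r i) (\mxcol_i c i) (\mxdiag_i B i)) =
  a * \prod_i \det (B i)
  - \sum_i (r i *m \adj (B i) *m c i) 0 0 * \prod_(j | j != i) \det (B j).
Proof.
move=> B_neq0; set M := block_mx _ _ _ _; set p := \prod_i _.
have p_neq0 : p != 0 by apply/prodf_neq0 => i _.
pose Q := \mxdiag_i ((\prod_(j | j != i) \det (B j)) *: \adj (B i)).
have BQ : \mxdiag_i B i *m Q = p%:M.
  rewrite mul_mxdiag -mxdiagZ; apply/eq_mxdiag => i.
  by rewrite -scalemxAr mul_mx_adj scale_scalar_mx mulrC /p [in RHS](bigD1 i) /=.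
have QcE : Q *m \mxcol_i c i =
    \mxcol_i ((\prod_(j | j != i) \det (B j)) *: (\adj (B i) *m c i)).
  by rewrite mul_mxdiag_mxcol; apply/eq_mxcol => i; rewrite scalemxAl.
pose T := block_mx p%:M 0 (- (Q *m \mxcol_i c i)) 1%:M.
have detT : \det T = p by rewrite /T det_lblock det1 mulr1 det_scalar1.
(* Both sides are multiplied by [p], which is [\det T] on the left; on the right it is the
   determinant of the diagonal block that survives in [M *m T]. *)
apply: (mulIf p_neq0); rewrite -{1}detT -det_mulmx mulmx_block.
rewrite !mulmx0 !mulmx1 !add0r !mulmxN (mulmxA (mxdiag _)) BQ.
rewrite !mul_mx_scalar mul_scalar_mx subrr.
rewrite det_ublock det_mxdiag -/p; congr (_ * _).
rewrite det_mx11 QcE mul_mxrow_mxcol !mxE summxE eqxx mulr1n mulrC; congr (_ - _).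
by apply: eq_bigr => i _; rewrite -scalemxAr mulmxA mxE mulrC.
Qed.


(** * The Coxeter polynomial as a determinant *)

Lemma row_sigma_mul (R : comNzRingType) (V : finType) (e : rel V) (n : nat)
    (v : 'I_n -> V) (i j : 'I_n) (A : 'M[R]_n) :
  row j (sigma R e v i *m A) = row j A
    - (\sum_l ((i == l)%:R *+ 2 - (e (v i) (v l))%:R) *: row l A) *+ (i == j).
Proof.
apply/rowP => c; rewrite !mxE.
transitivity (\sum_l ((j == l)%:R
    - ((i == l)%:R *+ 2 - (e (v i) (v l))%:R) *+ (i == j)) * A l c).
  apply: eq_bigr => l _; rewrite mxE /sigma_image !mxE !andbT.
  by rewrite (eq_sym j i) mulr_natr.
under eq_bigr do rewrite mulrBl; rewrite sumrB; congr (_ - _).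
  rewrite (bigD1 j) //= eqxx mul1r big1 ?addr0 // => l.
  by rewrite eq_sym => /negPf ->; rewrite mul0r.
case: eqP => _; last by rewrite mulr0n mxE big1 // => l _; rewrite mulr0n mul0r.
by rewrite !mulr1n summxE; apply: eq_bigr => l _; rewrite !mxE.
Qed.

(** Each reflection changes only its own row. When the factor of index [i] acts, the factors to its
    right have already given the rows of larger index in [s] their final value, and all other rows
    are still those of the identity. *)
Lemma row_prod_sigma (R : comNzRingType) (V : finType) (e : rel V) (n : nat)
    (v : 'I_n -> V) (s : seq 'I_n) (P := \prod_(i <- s) sigma R e v i) (i : 'I_n) :
    sorted (fun i j : 'I_n => i < j)%N s ->
  row i P = row i 1%:M - (\sum_l ((i == l)%:R *+ 2 - (e (v i) (v l))%:R)
    *: (if (l \in s) && (i < l)%N then row l P else row l 1%:M)) *+ (i \in s).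
Proof.
have lt_trans : transitive (fun i j : 'I_n => i < j)%N.
  by move=> ? ? ?; apply: ltn_trans.
rewrite {}/P; elim: s => [|k s IHs] in i *; first by rewrite big_nil subr0.
move=> ks_sorted; have s_sorted := path_sorted ks_sorted.
have ks : {in s, forall j : 'I_n, (k < j)%N} by apply/allP/(order_path_min lt_trans).
have kNs : k \notin s by apply/negP => /ks; rewrite ltnn.
rewrite big_cons; set P := \prod_(i <- s) _ in IHs *.
have rowP_out l : l \notin s -> row l P = row l 1%:M.
  by move=> lNs; rewrite IHs // (negPf lNs) subr0.
have row_kP l : l != k -> row l (sigma R e v k *m P) = row l P.
  by rewrite row_sigma_mul eq_sym => /negPf ->; rewrite subr0.
rewrite [LHS]row_sigma_mul in_cons.
have [<-|kNi] := eqVneq k i.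
  rewrite /= rowP_out //; congr (_ - _); apply: eq_bigr => l _.
  congr (_ *: _); rewrite in_cons; have [->|lNk] := eqVneq l k.
    by rewrite ltnn rowP_out.
  rewrite /= -[_ * _]/(_ *m _) row_kP //.
  by have [/ks ->|/rowP_out] := boolP (l \in s).
rewrite subr0 {1}IHs //=; congr (_ - _).
have [/ks ki|//] := boolP (i \in s); congr (_ *+ _); apply: eq_bigr => l _.
congr (_ *: _); rewrite in_cons; have [->|lNk] := eqVneq l k.
  by rewrite (negPf kNs) ltnNge ltnW.
by rewrite /= -[_ * _]/(_ *m _) row_kP.
Qed.

Lemma row_coxeter_transformation (R : comNzRingType) (V : finType) (e : rel V)
    (n : nat) (v : 'I_n -> V) (P := coxeter_transformation R e v) (i : 'I_n) :
  row i P = row i 1%:M - \sum_l ((i == l)%:R *+ 2 - (e (v i) (v l))%:R)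
    *: (if (i < l)%N then row l P else row l 1%:M).
Proof.
have PE : P = \prod_(j <- enum 'I_n) sigma R e v j by rewrite enumT.
rewrite PE row_prod_sigma; last first.
  have := iota_ltn_sorted 0 n; rewrite -val_enum_ord sorted_map.
  by apply: sub_sorted.
by rewrite mem_enum inE mulr1n; congr (_ - _); apply: eq_bigr => l _; rewrite mem_enum.
Qed.

(** These are the entries of t U + L for the vertex order given by [rk]. Keeping [rk] apart from the
    enumeration allows the order to change while the index set stays fixed. *)
Definition cox_entry (R : comNzRingType) (V : finType) (e : rel V)
    (rk : V -> nat) (x y : V) : {poly R} :=
  ('X + 1) *+ (x == y) - (if (rk x < rk y)%N then 'X else 1) *+ e x y.

Lemma coxeter_poly_det (R : comNzRingType) (V : finType) (e : rel V) (n : nat)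
    (v : 'I_n -> V) (rk : V -> nat) :
    irreflexive e -> (forall i, rk (v i) = i) ->
  coxeter_poly R e v = \det (\matrix_(i, j) cox_entry R e rk (v i) (v j)).
Proof.
move=> e_irr rkE; set P := coxeter_transformation R e v.
have v_inj : injective v by move=> i j vij; apply: val_inj; rewrite /= -!rkE vij.
pose U : 'M[R]_n := \matrix_(i, j) ((i == j)%:R - (e (v i) (v j) && (i < j)%N)%:R).
pose L : 'M[R]_n := \matrix_(i, j) ((i == j)%:R - (e (v i) (v j) && (j < i)%N)%:R).
have sum_delta i (F : 'I_n -> R) : \sum_l (i == l)%:R * F l = F i.
  rewrite (bigD1 i) //= eqxx mul1r big1 ?addr0 // => l.
  by rewrite eq_sym => /negPf ->; rewrite mul0r.
have UP : U *m P = - L.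
  apply/matrixP => i j; rewrite !mxE.
  under eq_bigr do rewrite mxE mulrBl; rewrite sumrB sum_delta.
  have /rowP/(_ j) := row_coxeter_transformation R e v i.
  rewrite !mxE summxE -/P => ->; rewrite -addrA -opprD -big_split /=.
  (* The terms containing row [l] of [P] for [l > i] cancel; the diagonal term and the edges to
     smaller indices remain. *)
  rewrite (eq_bigr (fun l => (i == l)%:R * ((l == j)%:R *+ 2)
      - (j == l)%:R * (e (v i) (v l) && (l < i)%N)%:R)).
    by rewrite sumrB !sum_delta; ring.
  move=> l _; rewrite mxE (eq_sym j); have [il|il|/val_inj <-] := ltngtP i l.
  - by rewrite mxE -(val_eqE i) /= ltn_eqF // andbT andbF /=; ring.
  - by rewrite !mxE -(val_eqE i) /= gtn_eqF // andbT andbF /=; ring.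
  - by rewrite !mxE e_irr eqxx /=; ring.
have detU : \det U = 1.
  rewrite -det_tr det_trig.
    by rewrite big1 // => i _; rewrite !mxE eqxx ltnn andbF subr0.
  apply/is_trig_mxP => i j ij; rewrite !mxE -val_eqE /=.
  by rewrite gtn_eqF // (ltnNge j) ltnW // andbF subr0.
rewrite /coxeter_poly /char_poly -[LHS]mul1r -[1](rmorph1 (@polyC R)) -detU.
rewrite -det_map_mx -det_mulmx; congr (\det _).
rewrite /char_poly_mx mulmxBr mul_mx_scalar -map_mxM UP.
apply/matrixP => i j; rewrite !mxE /cox_entry !rkE (inj_eq v_inj).
rewrite !(rmorphN, rmorphB, rmorph_nat) /=; have [ij|ij|/val_inj <-] := ltngtP i j.
- by rewrite -val_eqE /= ltn_eqF // andbT andbF; case: (e _ _) => /=; ring.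
- by rewrite -val_eqE /= gtn_eqF // andbT andbF; case: (e _ _) => /=; ring.
- by rewrite e_irr eqxx /=; ring.
Qed.

(** Changing the order can only exchange the entries [- 'X] and [- 1] at the two places of an edge,
    which keeps their product, so [det_acyclic] applies. This lets each tree use the order induced
    by an enumeration of the join. *)
Lemma coxeter_poly_rank (R : comNzRingType) (V : finType) (e : rel V) (n : nat)
    (v : 'I_n -> V) (rk : V -> nat) :
    is_tree e -> bijective v -> injective rk ->
  coxeter_poly R e v = \det (\matrix_(i, j) cox_entry R e rk (v i) (v j)).
Proof.
case=> e_sym e_irr _ e_acyclic [w vK wK] rk_inj; have v_inj := can_inj vK.
rewrite (@coxeter_poly_det _ _ _ _ _ (val \o w)) // => [|i]; last by rewrite /= vK.
apply: (det_acyclic (acyclic_graph_inj v_inj e_acyclic)).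
- by move=> i; rewrite !mxE /cox_entry !ltnn.
- move=> i j ij /negPf eij.
  by rewrite !mxE /cox_entry eij (inj_eq v_inj) (negPf ij) subr0.
- move=> i j; rewrite !mxE /cox_entry (e_sym (v j)) /= !vK.
  have [->|ij] := eqVneq i j; first by rewrite e_irr.
  rewrite !(inj_eq v_inj) (eq_sym j) (negPf ij) !mulr0n !sub0r !mulrNN.
  have : rk (v i) != rk (v j) by rewrite (inj_eq rk_inj) (inj_eq v_inj).
  move: ij; rewrite -val_eqE /=.
  by case: (ltngtP i j) => // _ _; case: (ltngtP (rk (v i))) => // _ _;
    case: (e _ _); rewrite /= ?mulr1n ?mulr0n ?mulr0 // mulrC.
Qed.

(** * Enumerating the join block by block, and its Coxeter polynomial *)

Definition join_enum (k : nat) (V : 'I_k -> finType) (n : 'I_k -> nat)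
    (s : forall i : 'I_k, 'I_(n i) -> V i)
    (a : 'I_(1 + \sum_i n i)) : option {i : 'I_k & V i} :=
  if split a is inr b then Some (Tagged V (s _ (tagnat.sig2 b))) else None.

Lemma join_enum_lshift (k : nat) (V : 'I_k -> finType) (n : 'I_k -> nat)
    (s : forall i : 'I_k, 'I_(n i) -> V i) (a : 'I_1) :
  join_enum s (lshift _ a) = None.
Proof. by rewrite /join_enum (unsplitK (inl a)). Qed.

Lemma join_enum_rshift (k : nat) (V : 'I_k -> finType) (n : 'I_k -> nat)
    (s : forall i : 'I_k, 'I_(n i) -> V i)
    (b : 'I_(\sum_i n i)) :
  join_enum s (rshift 1 b) = Some (Tagged V (s _ (tagnat.sig2 b))).
Proof. by rewrite /join_enum (unsplitK (inr b)). Qed.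

Lemma join_enum_bij (k : nat) (V : 'I_k -> finType) (n : 'I_k -> nat)
    (s : forall i : 'I_k, 'I_(n i) -> V i) :
  (forall i, bijective (s i)) -> bijective (join_enum s).
Proof.
move=> s_bij.
have /fin_all_exists[w wP] i : exists w : V i -> 'I_(n i),
  cancel (s i) w /\ cancel w (s i) by case: (s_bij i) => w; exists w.
exists (fun x => if x is Some y then rshift 1 (tagnat.Rank (tag y) (w _ (tagged y)))
                 else lshift _ ord0) => [a|[[i x]|]].
- rewrite -[a]splitK; case: (split a) => [b|b] /=.
    by rewrite join_enum_lshift [b]ord1.
  by rewrite join_enum_rshift /= (wP _).1 tagnat.sig2K.
- rewrite join_enum_rshift /tagnat.sig2 /tagnat.sig1 /tagnat.Rank tagnat.rankK /=.
  by rewrite (wP _).2.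
- exact: join_enum_lshift.
Qed.

(** The order of [t] is kept throughout: passing to [join_enum] permutes rows and columns together,
    and independence of the order is applied only inside each tree. *)
Lemma coxeter_poly_join (R : idomainType) (k : nat) (V : 'I_k -> finType)
    (e : forall i : 'I_k, rel (V i)) (v0 : forall i : 'I_k, V i)
    (n : 'I_k -> nat) (s : forall i : 'I_k, 'I_(n i) -> V i)
    (N : nat) (t : 'I_N -> option {i : 'I_k & V i}) :
    (forall i, is_tree (e i)) -> (forall i, bijective (s i)) -> bijective t ->
  exists g : 'I_k -> {poly R},
    coxeter_poly R (join_rel e v0) t =
    ('X + 1) * \prod_i coxeter_poly R (e i) (s i)
    - \sum_i g i * \prod_(j | j != i) coxeter_poly R (e j) (s j).
Proof.
move=> e_tree s_bij t_bij; have [w tK wK] := t_bij.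
(* [rki i] is the order that [t] induces on the tree of index [i]; it may differ from that of
   [s i]. *)
pose rk x : nat := w x; pose rki i (x : V i) := rk (Some (Tagged V x)).
have rki_inj i : injective (@rki i).
  by move=> x y /val_inj/(can_inj wK)/Some_inj/eqP; rewrite eq_Tagged => /eqP.
have join_irr : irreflexive (join_rel e v0).
  move=> [[i x]|//] /=; rewrite eqxx tagged_asE.
  by have [_ ->] := e_tree i.
pose B i := \matrix_(a, b) cox_entry R (e i) (@rki i) (s i a) (s i b).
pose r i : 'rV_(n i) :=
  \row_b cox_entry R (join_rel e v0) rk None (Some (Tagged V (s i b))).
pose c i : 'cV_(n i) :=
  \col_b cox_entry R (join_rel e v0) rk (Some (Tagged V (s i b))) None.
have coxB i : coxeter_poly R (e i) (s i) = \det (B i).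
  exact: coxeter_poly_rank.
exists (fun i => (r i *m \adj (B i) *m c i) 0 0).
under eq_bigr do rewrite coxB.
under [X in _ - X]eq_bigr do under eq_bigr do rewrite coxB.
(* The diagonal blocks have nonzero determinant because characteristic polynomials are monic. *)
rewrite -det_bordered_mxdiag => [|i]; last first.
  by rewrite -coxB monic_neq0 // char_poly_monic.
rewrite (@coxeter_poly_det _ _ _ _ _ rk) // => [|i]; last by rewrite /rk tK.
have [u uK Ku] := join_enum_bij s_bij.
rewrite -(@det_mxsub_bij _ _ _ (w \o join_enum s)); last first.
  by apply: bij_comp; [exists t | exists u].
congr (\det _); rewrite -[LHS]submxK; congr block_mx; apply/matrixP => a b;
  rewrite !mxE /= ?wK ?join_enum_lshift ?join_enum_rshift.
- by rewrite !ord1 /cox_entry /= subr0.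
- by [].
- by [].
(* In the lower right block, entries between distinct trees vanish since the join has no edge
   there. *)
- rewrite /tagnat.sig2 /tagnat.sig1.
  move: (tagnat.sig a) (tagnat.sig b) => [i x] [j y] /=.
  have [ij|ij] := eqVneq i j; last first.
    rewrite mxE /cox_entry /= (negPf ij) subr0 -[_ == _]/(Tagged V _ == Tagged V _).
    by rewrite -tag_eqE /tag_eq /= (negPf ij).
  case: j / ij in y *; rewrite conform_mx_id mxE /cox_entry /= eqxx tagged_asE.
  by rewrite -[Some _ == _]/(Tagged V _ == Tagged V _) eq_Tagged.
Qed.

(** * Multiplicity of the root *)

Lemma prod_XsubC_dvd (F : idomainType) (I : finType) (P : pred I)
    (q : I -> {poly F}) (mu : I -> nat) (z : F) :
    (forall i, ('X - z%:P) ^+ mu i %| q i) ->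
  ('X - z%:P) ^+ (\sum_(i | P i) mu i) %| \prod_(i | P i) q i.
Proof.
move=> dvd_q; rewrite -prodrXr.
by apply: (big_ind2 (fun a b : {poly F} => a %| b)) => // *; apply: dvdp_mul.
Qed.

(* The trees T_i have vertex type [V i], edge relation [e i], chosen vertex
   [v0 i] and vertex enumeration [s i]; the join is enumerated by [t].
   Each m - m_i is at most m, so [\big[minn/m]] is the plain minimum. *)
Theorem theorem2p7 (R : realType) (k : nat) (hk : (2 <= k)%N)
    (V : 'I_k -> finType) (e : forall i : 'I_k, rel (V i))
    (v0 : forall i : 'I_k, V i)
    (htree : forall i : 'I_k, is_tree (e i))
    (n : 'I_k -> nat) (s : forall i : 'I_k, 'I_(n i) -> V i)
    (hs : forall i : 'I_k, bijective (s i))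
    (N : nat) (t : 'I_N -> option {i : 'I_k & V i}) (ht : bijective t)
    (z : R[i]) (mu : 'I_k -> nat)
    (hroot : forall i : 'I_k,
       root (complex_poly (coxeter_poly R (e i) (s i))) z)
    (hmu : forall i : 'I_k,
       mup z (complex_poly (coxeter_poly R (e i) (s i))) = mu i) :
  let m := (\sum_(i < k) mu i)%N in
  let p := complex_poly (coxeter_poly R (join_rel e v0) t) in
  root p z /\ (\big[minn/m]_(i < k) (m - mu i)%N <= mup z p)%N.
Proof.
move=> m p; set d := \big[minn/m]_(i < k) _.
have cox_neq0 (W : finType) (f : rel W) l (w : 'I_l -> W) :
    complex_poly (coxeter_poly R f w) != 0.
  by rewrite map_poly_eq0 monic_neq0 // char_poly_monic.
pose q i := complex_poly (coxeter_poly R (e i) (s i)).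
have mu_gt0 i : (0 < mu i)%N.
  by rewrite -hmu -XsubC_dvd ?cox_neq0 // dvdp_XsubCl.
have m_sub i : (m - mu i = \sum_(j | j != i) mu j)%N.
  by rewrite /m (bigD1 i) //= addKn.
have d_dvd i : ('X - z%:P) ^+ d %| \prod_(j | j != i) q j.
  have d_le : (d <= \sum_(j | j != i) mu j)%N.
    by rewrite -m_sub; apply: (bigmin_le (T := nat)).
  apply: dvdp_trans (dvdp_exp2l _ d_le) _; apply: prod_XsubC_dvd => j.
  by rewrite -mup_geq ?cox_neq0 // hmu.
(* As [k >= 2], every index [i] has another index [j], and [mu j > 0] makes [m - mu i] positive. The
   default value [m] of the minimum is then positive too. This is what makes [z] a root. *)
have d_gt0 : (0 < d)%N.
  have other_idx (i : 'I_k) : exists j, j != i.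
    have [->|i_neq] := eqVneq i (Ordinal hk); last by exists (Ordinal hk); rewrite eq_sym.
    by exists (Ordinal (ltnW hk)).
  have sub_gt0 i : (0 < m - mu i)%N.
    have [j ji] := other_idx i.
    by rewrite m_sub (bigD1 j) //= addn_gt0 mu_gt0.
  apply: (big_ind (fun x => 0 < x)%N) => //.
  - by rewrite (leq_trans (sub_gt0 (Ordinal hk))) // leq_subr.
  - by move=> x y x_gt0 y_gt0; rewrite leq_min x_gt0.
have d_le : (d <= mup z p)%N.
  rewrite mup_geq ?cox_neq0 // /p.
  have [g ->] := coxeter_poly_join R v0 htree hs ht.
  rewrite /complex_poly rmorphB rmorphM rmorph_prod rmorph_sum /=.
  apply: dvdp_sub.
    (* The full product contains a product with one index omitted; any index would serve. *)
    by rewrite (bigD1 (Ordinal hk)) //= !dvdp_mull // d_dvd.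
  apply: (big_ind (fun x => _ %| x)) => [|x y|i _];
    [exact: dvdp0 | exact: dvdp_add |].
  by rewrite rmorphM rmorph_prod dvdp_mull // d_dvd.
split=> //; rewrite -dvdp_XsubCl XsubC_dvd ?cox_neq0 //.
exact: leq_trans d_le.
Qed.
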